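(* Let $S$ be a weak multiplication semiring. Then for every maximal ideal $\mathfrak{m}$ of $S$ there is no ideal $\mathfrak{a}$ of $S$ strictly between $\mathfrak{m}^2$ and $\mathfrak{m}$, i.e. no ideal $\mathfrak{a}$ with $\mathfrak{m}^2\subsetneq\mathfrak{a}\subsetneq\mathfrak{m}$.
   Context: A semiring is $(S,+,\cdot,0,1)$ where $(S,+,0)$ and $(S,\cdot,1)$ are commutative monoids, $1\neq 0$, multiplication distributes over addition, and $a\cdot 0=0$ for all $a$. An ideal of $S$ is a nonempty subset closed under addition and under multiplication by elements of $S$. The product $\mathfrak{b}\mathfrak{c}$ of ideals is the set of finite sums $\sum b_ic_i$ with $b_i\in\mathfrak{b}$, $c_i\in\mathfrak{c}$. A prime ideal is a proper ideal $\mathfrak{p}$ such that $ab\in\mathfrak{p}$ implies $a\in\mathfrak{p}$ or $b\in\mathfrak{p}$. A semiring $S$ is a weak multiplication semiring if, whenever $\mathfrak{a}\subseteq\mathfrak{p}$ with $\mathfrak{a}$ an ideal and $\mathfrak{p}$ a prime ideal of $S$, there exists an ideal $\mathfrak{c}$ of $S$ such that $\mathfrak{a}=\mathfrak{p}\mathfrak{c}$. *)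

(* Defs.v *)
From HB Require Import structures.
From mathcomp Require Import all_boot all_algebra.
From mathcomp Require Import boolp classical_sets.

Set Implicit Arguments.
Unset Strict Implicit.
Unset Printing Implicit Defensive.

Import GRing.Theory.
Local Open Scope ring_scope.
Local Open Scope classical_set_scope.

(* Semirings are commutative with 1 != 0, i.e. comNzSemiRingType.  The ideal
   predicates of ring_quotient are restricted to rings with opposites and to
   boolean sets, so they do not apply here. *)

Definition is_ideal (S : comNzSemiRingType) (I : set S) : Prop :=
  [/\ I !=set0,
      forall a b, I a -> I b -> I (a + b) &
      forall s a, I a -> I (s * a)].

Definition ideal_mul (S : comNzSemiRingType) (B C : set S) : set S :=
  [set x | exists n : nat, exists b : 'I_n -> S, exists c : 'I_n -> S,
     [/\ forall i, B (b i), forall i, C (c i) & x = \sum_(i < n) b i * c i]].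

Definition is_prime_ideal (S : comNzSemiRingType) (P : set S) : Prop :=
  [/\ is_ideal P, P <> setT & forall a b, P (a * b) -> P a \/ P b].

Definition is_maximal_ideal (S : comNzSemiRingType) (M : set S) : Prop :=
  [/\ is_ideal M, M <> setT &
      forall I : set S, is_ideal I -> M `<=` I -> I = M \/ I = setT].

Definition weak_multiplication (S : comNzSemiRingType) : Prop :=
  forall A P : set S, is_ideal A -> is_prime_ideal P -> A `<=` P ->
  exists C : set S, is_ideal C /\ A = ideal_mul P C.

(* Main.v *)
Require Import Defs.
From mathcomp Require Import all_boot all_algebra.
From mathcomp Require Import boolp classical_sets.
Local Open Scope classical_set_scope.

(** A maximal ideal [M] is prime, so an ideal [A] below [M] is [M * C] for some
    ideal [C]. If [C] lies in [M] then [A] lies in [M^2]; otherwise [1 = m + c]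
    with [m] in [M] and [c] in [C], and every [x] in [M] is
    [x * m + x * c], which lies in [M^2 + A = A]. *)

Import GRing.Theory.

Lemma ideal0 (S : comNzSemiRingType) (I : set S) : is_ideal I -> I 0%R.
Proof. by case=> -[a Ia] _ Is; rewrite -(mul0r a); apply: Is. Qed.

Lemma is_ideal_sum (S : comNzSemiRingType) (I J : set S) :
  is_ideal I -> is_ideal J ->
  is_ideal [set x | exists a b, [/\ I a, J b & x = (a + b)%R]].
Proof.
move=> hI hJ; case: (hI) => _ ID IM; case: (hJ) => _ JD JM; split.
- exists 0%R, 0%R, 0%R.
  by split; [apply: ideal0 | apply: ideal0 | rewrite addr0].
- move=> _ _ [a [b [Ia Jb ->]]] [c [d [Ic Jd ->]]].
  by exists (a + c)%R, (b + d)%R; split; [apply: ID | apply: JD | rewrite addrACA].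
- move=> s _ [a [b [Ia Jb ->]]].
  by exists (s * a)%R, (s * b)%R; split; [apply: IM | apply: JM | rewrite mulrDr].
Qed.

Lemma is_ideal_principal (S : comNzSemiRingType) (a : S) :
  is_ideal [set x | exists s, x = (s * a)%R].
Proof.
split.
- by exists a, 1%R; rewrite mul1r.
- by move=> _ _ [s ->] [t ->]; exists (s + t)%R; rewrite mulrDl.
- by move=> t _ [s ->]; exists (t * s)%R; rewrite mulrA.
Qed.

(** Maximality is applied to the ideal [M + C], which contains [M]. It cannot equal [M], as it
    contains [C], so it is all of [S] and contains [1]. *)
Lemma maximal_ideal_comaximal (S : comNzSemiRingType) (M C : set S) :
  is_maximal_ideal M -> is_ideal C -> ~ C `<=` M ->
  exists m c, [/\ M m, C c & 1%R = (m + c)%R].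
Proof.
move=> [hM _ maxM] hC nCM.
case: (maxM _ (is_ideal_sum _ _ _ hM hC)) => [x Mx|eqM|eqT].
- by exists x, 0%R; split; rewrite ?addr0 //; apply: ideal0.
- case: nCM => c Cc; rewrite -eqM.
  by exists 0%R, c; split; rewrite ?add0r //; apply: ideal0.
(* Membership of [1] in [M + C] unfolds to exactly the decomposition sought. *)
- by have : [set: S] 1%R by []; rewrite -eqT.
Qed.

(** If [a] is not in [M], then [M] and the principal ideal of [a] are comaximal, which stands in for
    inverting [a] modulo [M]. *)
Lemma maximal_ideal_prime (S : comNzSemiRingType) (M : set S) :
  is_maximal_ideal M -> is_prime_ideal M.
Proof.
move=> hM; case: (hM) => hMi MT _; split=> // a b Mab.
have [_ MD MM] := hMi.
have [Ma|nMa] := EM (M a); [by left | right].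
have [|m [_ [Mm [s ->] e]]] :=
  maximal_ideal_comaximal _ _ _ hM (is_ideal_principal _ a).
  by move=> /(_ a) sub; apply: nMa; apply: sub; exists 1%R; rewrite mul1r.
(* From [1 = m + s * a] comes [b = m * b + s * (a * b)], and both terms lie in [M]. *)
rewrite -(mul1r b) e mulrDl -mulrA; apply: MD; last exact: MM.
by rewrite mulrC; apply: MM.
Qed.

Lemma ideal_mulS (S : comNzSemiRingType) (B C D : set S) :
  C `<=` D -> ideal_mul B C `<=` ideal_mul B D.
Proof.
move=> CD _ [n [b [c [Bb Cc ->]]]]; exists n, b, c; split=> // i.
exact: CD.
Qed.

Lemma ideal_mul_mem (S : comNzSemiRingType) (B C : set S) (b c : S) :
  B b -> C c -> ideal_mul B C (b * c)%R.
Proof.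
move=> Bb Cc; exists 1, (fun=> b), (fun=> c).
by split=> //; rewrite big_ord1.
Qed.

Theorem theorem3p17 (S : comNzSemiRingType) (hS : weak_multiplication S)
    (M : set S) (hM : is_maximal_ideal M) :
  ~ (exists A : set S, [/\ is_ideal A, ideal_mul M M `<` A & A `<` M]).
Proof.
move=> [A [hA [M2A nAM2] [AM nMA]]].
have [C [hC eA]] := hS _ _ hA (maximal_ideal_prime _ _ hM) AM.
have [CM|nCM] := EM (C `<=` M).
  (* Here [A = M * C] falls inside [M * M], against the strictness of the lower inclusion. *)
  by apply: nAM2; rewrite eA; apply: ideal_mulS.
have [m [c [Mm Cc e]]] := maximal_ideal_comaximal _ _ _ hM hC nCM.
(* The upper inclusion is strict, so it suffices to place every [x] of [M] in [A]. *)
apply: nMA => x Mx; have [_ AD _] := hA.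
rewrite -(mulr1 x) e mulrDr; apply: AD.
- by apply: M2A; apply: ideal_mul_mem.
- by rewrite eA; apply: ideal_mul_mem.
Qed.
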